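(* As $\theta \to \infty$, $$\lambda_\theta = \frac{\ln \theta}{\theta} - \frac{\ln\ln\theta - \gamma}{\theta} + o\Bigl(\frac{1}{\theta}\Bigr),$$ where $\gamma \approx 0.577215$ is Euler's constant.
   Context: For $\theta > 0$, the generalized Golomb--Dickman constant is $\lambda_\theta := \lim_{n\to\infty} \mathbb{E}_n^{\theta}[L_n]/n$, where $L_n$ is the length of the longest cycle of a random permutation $\sigma$ in the symmetric group $S_n$ on $\{1,\dots,n\}$ distributed according to the Ewens measure $\mathbb{P}_n^{\theta}(\sigma) = \theta^{C(\sigma)}/\bigl(\theta(\theta+1)\cdots(\theta+n-1)\bigr)$, $C(\sigma)$ is the total number of cycles of $\sigma$ (fixed points included), and $\mathbb{E}_n^{\theta}$ is expectation with respect to $\mathbb{P}_n^{\theta}$. This limit exists and has the integral representation $$\lambda_\theta = \int_0^\infty \exp\bigl[-t - \theta E_1(t)\bigr]\,dt, \qquad E_1(x) = \int_x^\infty \frac{e^{-t}}{t}\,dt \quad (x>0),$$ which may be taken as the definition of $\lambda_\theta$ here. *)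

(* Defs.v *)
From mathcomp Require Import all_boot all_order all_algebra.
From mathcomp Require Import all_classical all_reals all_analysis.

Set Implicit Arguments.
Unset Strict Implicit.
Unset Printing Implicit Defensive.
Import Order.TTheory GRing.Theory Num.Theory numFieldNormedType.Exports.

Local Open Scope classical_set_scope.
Local Open Scope ring_scope.

(* Euler's constant, as the limit of 1 + 1/2 + ... + 1/n - ln n. *)
Definition euler_gamma (R : realType) : R :=
  limn (fun n : nat => \sum_(1 <= k < n.+1) (k%:R : R)^-1 - ln n%:R).

(* Meaningful for x > 0 only: for x <= 0 the integral diverges and Rintegral
   returns 0. *)
Definition expint1 (R : realType) (x : R) : R :=
  \int[lebesgue_measure]_(t in `]x, +oo[) (expR (- t) / t).

(* The integral representation of lim_n E_n^theta[L_n] / n, where L_n is the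
   longest cycle length of an Ewens(theta) random permutation of n points.
   The open interval keeps t in the domain t > 0 of expint1. *)
Definition golomb_dickman (R : realType) (theta : R) : R :=
  \int[lebesgue_measure]_(t in `]0, +oo[) expR (- t - theta * expint1 t).

(* Needed for the Landau notations at +oo; same pattern as the library's
   eventually_filterType. *)
Canonical pinfty_filterType (R : realType) :=
  FilterType (pinfty_nbhs R) (@filter_filter R _ proper_pinfty_nbhs).

(* Main.v *)
From HB Require Import structures.
Require Import Defs.
From mathcomp Require Import all_boot all_order all_algebra.
From mathcomp Require Import all_classical all_reals all_analysis.
From mathcomp Require Import measurable_realfun ring lra.
Import Order.TTheory GRing.Theory Num.Theory numFieldNormedType.Exports.

Set Implicit Arguments.
Unset Strict Implicit.
Unset Printing Implicit Defensive.

Local Open Scope classical_set_scope.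
Local Open Scope ring_scope.

(** Put E1 = expint1 and F(t) = exp(-theta E1(t)), a distribution function on
the half-line t > 0.  Since F' = theta (e^-t / t) F, the integrand
e^-t F(t) of the Golomb-Dickman integral equals t F'(t) / theta, so that
theta * lambda_theta is the mean of F, that is, the integral of 1 - F over
t > 0 (golomb_dickman_mean).

For large theta the law F, moved back by a = ln theta - ln ln theta, is close
to the Gumbel law exp(-e^-s): as E1(x) lies between e^-x / (x + 1) and
e^-x / x, and theta e^-a = ln theta, the exponent theta E1(a + s) lies between
e^-s ln theta / (a + s + 1) and e^-s ln theta / (a + s), while
a / ln theta -> 1.  The same bounds dominate everything by a multiple of
e^-|s|, and dominated convergence shows that mean - a tends to the mean of the
Gumbel law, written as the integral of 1_(s >= 0) - exp(-e^-s).

That this Gumbel mean is Euler's constant needs no separate computation of an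
integral: the harmonic number H_n is the mean of the maximum of n independent
standard exponential variables, with distribution function (1 - e^-t)^n, and
this law moved back by ln n is (1 - e^-s / n)^n, which also tends to
exp(-e^-s) under a bound of the same kind.  The convergence lemma
cvg_mean_sub therefore applies to both families, and
theta * lambda_theta - (ln theta - ln ln theta) has the same limit as
H_n - ln n.  Dividing by theta gives the expansion. *)

(** * Integrals over a half-line *)

Lemma is_derive_continuous {R : realType} (F : R -> R) (x d : R) :
  is_derive x 1 F d -> {for x, continuous F}.
Proof. by case=> dF _; apply/differentiable_continuous/derivable1_diffP. Qed.

Section integration_on_a_ray.
Context {R : realType}.
Notation mu := (@lebesgue_measure R).

(** The fundamental theorem on a half-line: compact intervals exhaust the
half-line, and |f| dominates the restrictions of f to them.  Because f is
assumed integrable, it may change sign, and it need not extend continuously to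
a; the derivative of -t(1 - F(t)) below needs both freedoms. *)
Lemma Rintegral_derive_ray (f F : R -> R) (a l0 l : R) :
  mu.-integrable `]a, +oo[ (EFin \o f) ->
  (forall x, a < x -> {for x, continuous f}) ->
  (forall x, a < x -> is_derive x 1 F (f x)) ->
  F x @[x --> a^'+] --> l0 -> F x @[x --> +oo] --> l ->
  \int[mu]_(x in `]a, +oo[) f x = l - l0.
Proof.
move=> intf cf dF Fl0 Fl.
pose u (n : nat) : R := a + n.+2%:R^-1.
pose v (n : nat) : R := a + n.+2%:R.
have au n : a < u n by rewrite /u ltrDl invr_gt0.
have uv n : u n < v n.
  rewrite /u /v ltrD2l (@lt_trans _ _ 1)// ?ltr1n// invf_lt1// ltr1n//.
pose I n : set R := `[u n, v n]%classic.
have subI n : I n `<=` `]a, +oo[%classic.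
  by move=> x; rewrite /I /= !in_itv/= andbT => /andP[+ _]; exact: lt_le_trans.
have cF x : a < x -> {for x, continuous F}.
  by move=> /dF; exact: is_derive_continuous.
have mf : measurable_fun `]a, +oo[%classic f.
  by apply/measurable_EFinP; exact: measurable_int intf.
have FTCn n : (\int[mu]_(x in `]a, +oo[) ((f \_ (I n)) x)%:E)%E =
    (F (v n) - F (u n))%:E.
  rewrite EFinB -(@continuous_FTC2 _ f F)//; last 3 first.
  - apply: continuous_in_subspaceT => x; rewrite inE => /(subI n) /=.
    by rewrite in_itv/= andbT => /cf.
  - split.
    + move=> x; rewrite in_itv/= => /andP[ux _].
      by have [] := dF x (lt_trans (au n) ux).
    + exact/cvg_at_right_filter/cF.
    + exact/cvg_at_left_filter/cF/(lt_trans (au n)).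
  - move=> x; rewrite in_itv/= => /andP[ux _].
    by have [_ <-] := dF x (lt_trans (au n) ux); rewrite derive1E.
  rewrite (_ : `[u n, v n]%classic = `]a, +oo[%classic `&` I n); last first.
    by rewrite setIC; apply/esym/setIidPl.
  by rewrite integral_mkcondr; apply: eq_integral => x _; rewrite restrict_EFin.
have cvgI : (\int[mu]_(x in `]a, +oo[) ((f \_ (I n)) x)%:E)%E @[n --> \oo] -->
    (\int[mu]_(x in `]a, +oo[) (f x)%:E)%E.
  apply: (@dominated_cvg _ _ _ mu _ _ _ _ (EFin \o (fun x => `|f x|))) => //.
  - move=> n; apply/measurable_EFinP/measurable_restrict => //.
      by rewrite /I; exact: measurable_itv.
    by apply: measurable_funS mf => // x [].
  - move=> x /=; rewrite in_itv/= andbT => ax.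
    apply: cvg_near_cst; near=> n.
    rewrite patchE mem_set// /I/= in_itv/= /u /v.
    apply/andP; split.
      rewrite -lerBrDl -[leRHS]invrK lef_pV2 ?posrE ?invr_gt0 ?subr_gt0//.
      near: n; apply: filterS (nbhs_infty_ger (x - a)^-1) => n /le_trans; apply.
      by rewrite ler_nat -addn2 leq_addr.
    rewrite -lerBlDl.
    near: n; apply: filterS (nbhs_infty_ger (x - a)) => n /le_trans; apply.
    by rewrite ler_nat -addn2 leq_addr.
  - exact: integrable_norm.
  - move=> n x _ /=; rewrite lee_fin patchE; case: ifPn => // _.
    by rewrite normr0.
have cvgu : u n @[n --> \oo] --> a.
  rewrite -[X in _ --> X]addr0; apply: cvgD; first exact: cvg_cst.
  have := @cvg_harmonic R; rewrite -(cvg_shiftn 1); apply: cvg_trans.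
  by apply: near_eq_cvg; apply: nearW => n /=; rewrite addn1.
have cvgv : v n @[n --> \oo] --> +oo.
  apply/cvgryPge => r; near=> n; rewrite /v -lerBlDl.
  near: n; apply: filterS (nbhs_infty_ger (r - a)) => n /le_trans; apply.
  by rewrite ler_nat -addn2 leq_addr.
have cvgF : (F (v n) - F (u n)) @[n --> \oo] --> l - l0.
  apply: cvgB; first by move/cvg_pinftyP: Fl; exact.
  by move/cvg_at_rightP: Fl0; apply; split.
move: cvgI; under eq_fun do rewrite FTCn.
rewrite /Rintegral => /cvg_lim <-//.
have -> : limn (fun n => (F (v n) - F (u n))%:E) = (l - l0)%:E.
  by apply/cvg_lim => //; apply: cvg_EFin => //; exact: nearW.
done.
Unshelve. all: by end_near. Qed.
End integration_on_a_ray.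

Section exponential_tails.
Context {R : realType}.
Notation mu := (@lebesgue_measure R).

Lemma dominated_integrable_EFin (D : set R) (f g : R -> R) :
  measurable D -> measurable_fun D f -> mu.-integrable D (EFin \o g) ->
  (forall x, D x -> `|f x| <= g x) -> mu.-integrable D (EFin \o f).
Proof.
move=> mD mf intg fg; apply: le_integrable intg => //.
  exact/measurable_EFinP.
by move=> x Dx /=; rewrite lee_fin (le_trans (fg _ Dx))// ler_norm.
Qed.

Lemma continuous_ray_measurable (f : R -> R) (a : R) :
  (forall x, a < x -> {for x, continuous f}) -> measurable_fun `]a, +oo[ f.
Proof.
move=> cf; apply: open_continuous_measurable_fun => //.
by move=> x; rewrite inE/= in_itv/= andbT; exact: cf.
Qed.

Lemma is_derive_expRN (x : R) : is_derive x 1 (fun t => expR (- t)) (- expR (- x)).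
Proof. by apply: is_derive_eq; rewrite mulrN1. Qed.

Lemma continuous_expRN (x : R) : {for x, continuous (fun t => expR (- t))}.
Proof. exact: is_derive_continuous (is_derive_expRN x). Qed.

Lemma integral_expRN_ray (a : R) :
  (\int[mu]_(t in `]a, +oo[) (expR (- t))%:E = (expR (- a))%:E)%E.
Proof.
have mexp : measurable_fun setT (fun t : R => expR (- t)).
  by apply: continuous_measurable_fun => x; exact: continuous_expRN.
rewrite integral_itv_obnd_cbnd; last exact/measurable_EFinP/measurable_funTS.
rewrite (@ge0_continuous_FTC2y _ _ (fun t => - expR (- t)) _ 0)//.
- by rewrite EFinN oppeK add0e.
- by apply: continuous_subspaceT => x; exact: continuous_expRN.
- by rewrite -[X in _ --> X]oppr0; apply: cvgN; exact: cvgr_expR.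
- by apply: cvg_at_right_filter; apply: cvgN; exact: continuous_expRN.
- move=> x _; rewrite derive1E.
  have [_ ->] : is_derive x 1 (fun t => - expR (- t)) (- - expR (- x)).
    by apply: is_deriveN; exact: is_derive_expRN.
  by rewrite opprK.
Qed.

Lemma integrable_expRN_ray (a : R) :
  mu.-integrable `]a, +oo[ (EFin \o (fun t => expR (- t))).
Proof.
apply/integrableP; split.
  apply/measurable_EFinP; apply: continuous_ray_measurable => x _.
  exact: continuous_expRN.
under eq_integral do rewrite /= ger0_norm ?expR_ge0//.
by rewrite integral_expRN_ray ltry.
Qed.

Lemma Rintegral_expRN_ray (a : R) :
  \int[mu]_(t in `]a, +oo[) expR (- t) = expR (- a).
Proof. by rewrite /Rintegral integral_expRN_ray. Qed.

Lemma integrable_expRN_norm :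
  mu.-integrable setT (EFin \o (fun t : R => expR (- `|t|))).
Proof.
have cf : continuous (fun t : R => expR (- `|t|)).
  move=> x; apply: (@continuous_comp _ _ _ (fun t : R => `|t|) (fun t => expR (- t))).
    exact: norm_continuous.
  exact: continuous_expRN.
apply/integrableP; split.
  by apply/measurable_EFinP; exact: continuous_measurable_fun.
under eq_integral do rewrite /= ger0_norm ?expR_ge0//.
rewrite ge0_symfun_integralT//; last by move=> x /=; rewrite normrN.
rewrite -set_itvcy -integral_itv_obnd_cbnd; last first.
  apply/measurable_EFinP; apply: measurable_funTS.
  exact: continuous_measurable_fun.
under eq_integral => x do
  [rewrite inE/= in_itv/= andbT => x0; rewrite (gtr0_norm x0)].
by rewrite integral_expRN_ray -EFinM ltry.
Qed.
End exponential_tails.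

(** * The exponential integral *)

Section exponential_integral.
Context {R : realType}.
Notation mu := (@lebesgue_measure R).
Local Notation E1 := (@expint1 R).

Lemma continuous_expint1_integrand (x : R) : 0 < x ->
  {for x, continuous (fun t => expR (- t) / t)}.
Proof.
move=> x0; apply: cvgM; first exact: continuous_expRN.
by apply: cvgV => //; rewrite gt_eqF.
Qed.

Lemma integrable_expint1_integrand (x : R) : 0 < x ->
  mu.-integrable `]x, +oo[ (EFin \o (fun t => expR (- t) / t)).
Proof.
move=> x0; apply: (@dominated_integrable_EFin _ _ _ (fun t => x^-1 * expR (- t))) => //.
- apply: continuous_ray_measurable => y xy.
  exact/continuous_expint1_integrand/(lt_trans x0).
- exact: (integrableZl _ _ (integrable_expRN_ray x)).
- move=> y /=; rewrite in_itv/= andbT => xy.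
  have y0 : 0 < y by exact: lt_trans xy.
  rewrite ger0_norm ?divr_ge0 ?expR_ge0 ?(ltW y0)// mulrC ler_wpM2r ?expR_ge0//.
  by rewrite lef_pV2 ?posrE// ltW.
Qed.

Lemma expint1_ge0 (x : R) : 0 < x -> 0 <= E1 x.
Proof.
move=> x0; apply: Rintegral_ge0 => t /=; rewrite in_itv/= andbT => xt.
by rewrite divr_ge0 ?expR_ge0// ltW// (lt_trans x0).
Qed.

Lemma expint1_le (x : R) : 0 < x -> E1 x <= expR (- x) / x.
Proof.
move=> x0; rewrite -Rintegral_expRN_ray -RintegralZr//; last exact: integrable_expRN_ray.
apply: le_Rintegral => //; first exact: integrable_expint1_integrand.
  exact: (integrableZr _ _ (integrable_expRN_ray x)).
move=> t /=; rewrite in_itv/= andbT => xt; rewrite ler_wpM2l ?expR_ge0//.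
by rewrite lef_pV2 ?posrE ?(ltW xt)// (lt_trans x0).
Qed.

(** The function e^-t / (t + 1) has minus its derivative equal to
e^-t (r + r^2) with r = 1 / (t + 1), and r + r^2 <= 1 / t because the
difference is r^2 / t. *)
Lemma expint1_ge (x : R) : 0 < x -> expR (- x) / (x + 1) <= E1 x.
Proof.
move=> x0.
pose r (t : R) := (t + 1)^-1; pose G (t : R) := - (expR (- t) * r t).
pose g (t : R) := expR (- t) * (r t + r t * r t).
have dr (t : R) : 0 < t -> is_derive t 1 r (- (r t * r t)).
  move=> t0; have t1 : t + 1 != 0 by rewrite gt_eqF// addr_gt0.
  have d1 : is_derive t 1 (fun t : R => t + 1) 1.
    by apply: is_derive_eq; rewrite addr0.
  apply: (is_derive_eq (@is_deriveV R (fun t => t + 1) t 1 1 t1 d1)).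
  by rewrite /r scaler1 expr2 invfM.
have dG (t : R) : 0 < t -> is_derive t 1 G (g t).
  move=> t0.
  apply: (is_derive_eq (is_deriveN (is_deriveM (is_derive_expRN t) (dr _ t0)))).
  by rewrite /g /GRing.scale/=; ring.
have cr (t : R) : 0 < t -> {for t, continuous r}.
  by move=> /dr; exact: is_derive_continuous.
have cg (t : R) : x < t -> {for t, continuous g}.
  move=> xt; have t0 := lt_trans x0 xt.
  apply: cvgM; first exact: continuous_expRN.
  by apply: cvgD; [exact: cr|apply: cvgM; exact: cr].
have g0 (t : R) : x < t -> 0 <= g t.
  move=> xt; have t0 : 0 <= t by rewrite ltW// (lt_trans x0 xt).
  by rewrite mulr_ge0 ?expR_ge0// addr_ge0 ?mulr_ge0 ?invr_ge0 ?addr_ge0.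
have gle (t : R) : x < t -> g t <= expR (- t) / t.
  move=> xt; have t0 := lt_trans x0 xt.
  rewrite /g ler_wpM2l ?expR_ge0// -subr_ge0.
  have -> : t^-1 - (r t + r t * r t) = r t * r t / t.
    by rewrite /r; field; rewrite !gt_eqF// addr_gt0.
  by rewrite !mulr_ge0 ?invr_ge0 ?addr_ge0 ?(ltW t0).
have intg : mu.-integrable `]x, +oo[ (EFin \o g).
  apply: (@dominated_integrable_EFin _ _ _ (fun t => expR (- t) / t)) => //.
  - exact: continuous_ray_measurable.
  - exact: integrable_expint1_integrand.
  - by move=> t /=; rewrite in_itv/= andbT => xt; rewrite ger0_norm ?g0 ?gle.
have G_cvg : G t @[t --> +oo] --> (0 : R).
  apply: (@squeeze_cvgr _ _ _ _ (fun t => - expR (- t)) (cst 0)).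
  - near=> t.
    have t0 : 0 <= t by near: t; exact: nbhs_pinfty_ge.
    rewrite /G lerN2 oppr_le0 mulr_ge0 ?expR_ge0 ?invr_ge0 ?addr_ge0// andbT.
    by rewrite ler_piMr ?expR_ge0// /r invf_le1 ?ltr_wpDl// lerDr.
  - by rewrite -[X in _ --> X]oppr0; apply: cvgN; exact: cvgr_expR.
  - exact: cvg_cst.
have intgE : \int[mu]_(t in `]x, +oo[) g t = expR (- x) / (x + 1).
  have -> : expR (- x) / (x + 1) = 0 - G x by rewrite /G opprK add0r.
  apply: (@Rintegral_derive_ray _ _ G) => //.
  - by move=> t xt; apply: dG; exact: lt_trans xt.
  - exact/cvg_at_right_filter/(is_derive_continuous (dG _ x0)).
rewrite -intgE; apply: le_Rintegral => //; first exact: integrable_expint1_integrand.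
by move=> t /=; rewrite in_itv/= andbT; exact: gle.
Unshelve. all: by end_near. Qed.

(** Splitting the integral at x / 2 writes expint1, near x, as a constant minus
an integral with variable upper end. *)
Lemma is_derive_expint1 (x : R) : 0 < x -> is_derive x 1 E1 (- (expR (- x) / x)).
Proof.
move=> x0; pose y := x / 2.
have y0 : 0 < y by rewrite divr_gt0.
have yx : y < x by rewrite /y ltr_pdivrMr// mulr2n mulrDr mulr1 ltrDl.
pose f (t : R) := expR (- t) / t.
have intf : mu.-integrable `]y, +oo[ (EFin \o f) by exact: integrable_expint1_integrand.
have [] := @continuous_FTC1 R f (BRight y) x (x + 1).
- by rewrite ltrDl.
- by apply: integrableS intf => //; exact: subset_itvl.
- by [].
- exact: continuous_expint1_integrand.
move=> dP P'.
apply: (@near_eq_is_derive _ _ _ (fun z => E1 y - \int[mu]_(t in `]y, z]) f t)).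
- near=> z; rewrite (@Rintegral_itvB _ f (BRight y) +oo%O z)// bnd_simp ltW//.
  by near: z; exact: lt_nbhsr.
- have dI : is_derive x 1 (fun z => \int[mu]_(t in `]y, z]) f t) (expR (- x) / x).
    apply: DeriveDef; first exact: dP.
    by rewrite -derive1E; exact: P'.
  rewrite -[X in is_derive _ _ _ X]sub0r.
  exact: (@is_deriveB _ _ _ (cst (E1 y)) _ x 1 0 _ (is_derive_cst _ _ _) dI).
Unshelve. all: by end_near. Qed.
End exponential_integral.

(** * The Golomb-Dickman integral as the mean of a distribution *)

Section mean_of_a_distribution.
Context {R : realType}.
Notation mu := (@lebesgue_measure R).

Definition gd_cdf (theta t : R) : R := expR (- (theta * expint1 t)).

Lemma gd_cdf_ge0 (theta t : R) : 0 <= gd_cdf theta t.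
Proof. exact: expR_ge0. Qed.

Lemma gd_cdf_le1 (theta t : R) : 0 <= theta -> 0 < t -> gd_cdf theta t <= 1.
Proof.
by move=> th0 t0; rewrite /gd_cdf expR_le1 oppr_le0 mulr_ge0// expint1_ge0.
Qed.

Lemma gd_tail_le (theta t : R) : 0 <= theta -> 0 < t ->
  1 - gd_cdf theta t <= theta * (expR (- t) / t).
Proof.
move=> th0 t0; rewrite lerBlDl -lerBlDr.
apply: le_trans (expR_ge1Dx _); rewrite lerD2l lerN2.
by rewrite ler_wpM2l ?expint1_le.
Qed.

Lemma is_derive_gd_cdf (theta t : R) : 0 < t ->
  is_derive t 1 (gd_cdf theta) (gd_cdf theta t * (theta * (expR (- t) / t))).
Proof.
move=> t0.
have d1 : is_derive t 1 (fun t => - (theta * expint1 t)) (theta * (expR (- t) / t)).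
  rewrite -[X in is_derive _ _ _ X]opprK -mulrN.
  exact: (is_deriveN (is_deriveZ theta (is_derive_expint1 t0))).
exact: (@is_derive1_comp _ (@expR R) (fun t => - (theta * expint1 t)) t _ _ _ d1).
Qed.

Lemma continuous_gd_cdf (theta t : R) : 0 < t -> {for t, continuous (gd_cdf theta)}.
Proof. by move=> t0; exact: is_derive_continuous (is_derive_gd_cdf theta t0). Qed.

Lemma measurable_gd_cdf (theta : R) :
  measurable_fun (`]0, +oo[%classic : set R) (gd_cdf theta).
Proof. by apply: continuous_ray_measurable => t; exact: continuous_gd_cdf. Qed.

Lemma integrable_gd_tail (theta : R) : 0 <= theta ->
  mu.-integrable `]0, +oo[ (EFin \o (fun t => 1 - gd_cdf theta t)).
Proof.
move=> th0.
(* For t >= 1 the tail is at most theta e^-t; for t < 1 it is at most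
   1 <= e * e^-t. *)
apply: (@dominated_integrable_EFin _ _ _ (fun t => (theta + expR 1) * expR (- t))) => //.
- by apply: measurable_funB => //; exact: measurable_gd_cdf.
- exact: (integrableZl _ _ (integrable_expRN_ray 0)).
move=> t /=; rewrite in_itv/= andbT => t0.
rewrite ger0_norm ?subr_ge0 ?gd_cdf_le1// mulrDl.
have [t1|t1] := leP 1 t.
  apply: (le_trans (gd_tail_le th0 t0)); apply: ler_wpDr.
    by rewrite mulr_ge0 ?expR_ge0.
  by rewrite ler_wpM2l// ler_piMr ?expR_ge0// invf_le1.
apply: ler_wpDl; first by rewrite mulr_ge0 ?expR_ge0.
apply: (@le_trans _ _ 1); first by rewrite lerBlDr lerDl gd_cdf_ge0.
by rewrite -expRD -[leLHS]expR0 ler_expR subr_ge0 ltW.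
Qed.

(** Integration by parts: -t(1 - F(t)) has derivative theta e^-t F(t) - (1 - F(t))
and vanishes at both ends, at 0 because 1 - F <= 1 and at infinity because
t(1 - F(t)) <= theta e^-t. *)
Lemma golomb_dickman_mean (theta : R) : 0 <= theta ->
  theta * golomb_dickman theta = \int[mu]_(t in `]0, +oo[) (1 - gd_cdf theta t).
Proof.
move=> th0.
pose Phi (t : R) := - (t * (1 - gd_cdf theta t)).
pose w (t : R) := theta * (expR (- t) * gd_cdf theta t).
have intew : mu.-integrable `]0, +oo[ (EFin \o (fun t => expR (- t) * gd_cdf theta t)).
  apply: (@dominated_integrable_EFin _ _ _ (fun t => expR (- t))) => //.
  - apply: measurable_funM; last exact: measurable_gd_cdf.
    by apply: continuous_ray_measurable => t _; exact: continuous_expRN.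
  - exact: integrable_expRN_ray.
  - move=> t /=; rewrite in_itv/= andbT => t0.
    by rewrite ger0_norm ?mulr_ge0 ?expR_ge0// ler_piMr ?expR_ge0 ?gd_cdf_le1.
have intw : mu.-integrable `]0, +oo[ (EFin \o w) by exact: (integrableZl _ theta intew).
have dPhi (t : R) : 0 < t -> is_derive t 1 Phi (w t - (1 - gd_cdf theta t)).
  move=> t0.
  have d1 : is_derive t 1 (fun t => 1 - gd_cdf theta t)
      (0 - (gd_cdf theta t * (theta * (expR (- t) / t)))).
    exact: (@is_deriveB R R R (cst 1) (gd_cdf theta) t 1 0 _ (is_derive_cst _ _ _)
      (is_derive_gd_cdf theta t0)).
  apply: (is_derive_eq (is_deriveN (is_deriveM (is_derive_id t 1) d1))).
  by rewrite /w /GRing.scale/=; field; rewrite gt_eqF.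
have Phi0 (t : R) : 0 < t -> Phi t <= 0.
  by move=> t0; rewrite oppr_le0 mulr_ge0 ?(ltW t0)// subr_ge0 gd_cdf_le1.
apply/eqP; rewrite -subr_eq0; apply/eqP.
rewrite /golomb_dickman.
under eq_Rintegral do rewrite expRD.
rewrite -RintegralZl// -RintegralB//; last exact: integrable_gd_tail.
rewrite -[RHS](subrr 0); apply: (@Rintegral_derive_ray _ _ Phi) => //.
- exact: (integrableB _ intw (integrable_gd_tail th0)).
- move=> t t0; have ct := @continuous_gd_cdf theta t t0.
  apply: cvgB; last by apply: cvgB => //; exact: cvg_cst.
  apply: cvgM; first exact: cvg_cst.
  by apply: cvgM => //; exact: continuous_expRN.
- apply: (@squeeze_cvgr _ _ _ _ -%R (cst 0)).
  + near=> t; have t0 : 0 < t by [].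
    rewrite Phi0// andbT lerN2 ler_piMr ?(ltW t0)//.
    by rewrite lerBlDr lerDl gd_cdf_ge0.
  + rewrite -[X in _ --> X]oppr0; apply: cvgN.
    exact: cvg_at_right_filter.
  + exact: cvg_cst.
- apply: (@squeeze_cvgr _ _ _ _ (fun t => - (theta * expR (- t))) (cst 0)).
  + near=> t; have t0 : 0 < t by near: t; exact: nbhs_pinfty_gt.
    rewrite Phi0// andbT lerN2 (le_trans (ler_wpM2l (ltW t0) (gd_tail_le th0 t0)))//.
    by rewrite mulrCA (mulrC t) divfK ?gt_eqF.
  + rewrite -[X in _ --> X]oppr0 -[X in - X](mulr0 theta); apply: cvgN.
    by apply: cvgM; [exact: cvg_cst|exact: cvgr_expR].
  + exact: cvg_cst.
Unshelve. all: by end_near. Qed.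
End mean_of_a_distribution.

(** * Means recentred at infinity *)

Section recentred_means.
Context {R : realType}.
Notation mu := (@lebesgue_measure R).

Lemma pushforward_lebesgue_translation (a : R) (A : set R) : measurable A ->
  mu A = pushforward mu (fun s : R => a + s) A.
Proof.
move=> mA.
have mphi : measurable_fun setT
    ((fun s => a + s) : measurableTypeR R -> measurableTypeR R).
  by apply: measurable_funD.
pose phi_mixin := isMeasurableFun.Build _ _ _ _ _ mphi.
pose phi : {mfun measurableTypeR R >-> measurableTypeR R} :=
  HB.pack ((fun s => a + s) : measurableTypeR R -> measurableTypeR R) phi_mixin.
have := @lebesgue_measure_unique R (pushforward mu phi); apply=> //.
move=> _ [[x y] _ <-]; rewrite /pushforward.
have preimE : (fun s => a + s) @^-1` `]x, y] = `]x - a, y - a]%classic.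
  by apply/seteqP; split=> s /=; rewrite !in_itv/= ltrBlDl lerBrDl.
rewrite -[RHS]/(mu ((fun s => a + s) @^-1` `]x, y]%classic)) preimE.
rewrite !lebesgue_measure_itv/= !lte_fin ltrD2r; case: ifPn => // _.
by rewrite -!EFinB; congr EFin; ring.
Qed.

Lemma integral_translation (a : R) (f : R -> R) :
  mu.-integrable setT (EFin \o f) ->
  mu.-integrable setT (EFin \o (fun s => f (a + s))) /\
  \int[mu]_s f (a + s) = \int[mu]_s f s.
Proof.
move=> intf.
have mphi : measurable_fun setT
    ((fun s => a + s) : measurableTypeR R -> measurableTypeR R).
  by apply: measurable_funD.
have mf : measurable_fun setT (EFin \o f) := measurable_int _ intf.
have intfa : mu.-integrable setT (EFin \o (fun s => f (a + s))).
  case/integrableP : intf => _ foo; apply/integrableP; split.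
    by apply: (measurableT_comp mf).
  rewrite -[X in (X < _)%E](@ge0_integral_pushforward _ _ _ _ _ _ mphi mu setT
    (abse \o (EFin \o f)))//.
  - rewrite (@eq_measure_integral _ _ _ _ mu)// => A mA _.
    exact/esym/pushforward_lebesgue_translation.
  - exact: measurableT_comp.
  - by move=> x _; exact: abse_ge0.
split=> //; rewrite /Rintegral.
rewrite -[X in fine X = _](@integral_pushforward _ _ _ _ _ _ mphi mu setT (EFin \o f))//.
congr fine; apply/esym/eq_measure_integral => A mA _.
exact: pushforward_lebesgue_translation.
Qed.

(** For a random variable T > 0 with distribution function F, this is
P(T - a > s) - 1_(s < 0), whose integral over the line is the mean of
T - a.  The factor 1_(a + s > 0) extends F by 0 to the negative half-line, so
that F can be any formula meaningful for positive arguments. *)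
Definition recentred_excess (F : R -> R) (a s : R) : R :=
  (0 <= s)%R%:R - (0 < a + s)%R%:R * F (a + s).

(** The same function for the Gumbel law exp(-e^-s), with a = 0. *)
Definition gumbel_excess (s : R) : R := (0 <= s)%R%:R - expR (- expR (- s)).

(** Moved by a, the excess is the function (1 - F) 1_(t > 0) minus the indicator
of ]0, a[. *)
Lemma mean_sub_eq_integral_excess (F : R -> R) (a : R) : 0 < a ->
  mu.-integrable `]0, +oo[ (EFin \o (fun t => 1 - F t)) ->
  mu.-integrable setT (EFin \o recentred_excess F a) /\
  \int[mu]_(t in `]0, +oo[) (1 - F t) - a = \int[mu]_s recentred_excess F a s.
Proof.
move=> a0 intF.
pose p := (fun t => 1 - F t) \_ `]0, +oo[.
pose q : R -> R := \1_(`]0, a[).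
have intp : mu.-integrable setT (EFin \o p).
  by rewrite /p -restrict_EFin -integrable_mkcond.
have intq : mu.-integrable setT (EFin \o q) by exact: integrable_indic_itv.
have -> : recentred_excess F a = (fun s => p (a + s) - q (a + s)).
  apply/funext => s; rewrite /recentred_excess /p /q indicE patchE.
  rewrite !mem_setE !in_itv/= andbT gtrDl leNgt (_ : point = 0 :> R)//.
  have [t0|t0] := ltP 0 (a + s); have [s0|s0] := ltP s 0;
    rewrite /= ?mul1r ?mul0r ?mulr1n ?mulr0n; lra.
have intpq : mu.-integrable setT (EFin \o (fun t => p t - q t)).
  exact: (integrableB _ intp intq).
have [? ->] := integral_translation a intpq; split=> //.
rewrite [X in _ = X]RintegralB// [X in X - _ = _]Rintegral_mkcond; congr (_ - _).
rewrite /Rintegral integral_indic// setIT.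
rewrite -[LHS]/(fine a%:E); congr fine; apply/esym.
suff : mu `]0, a[%classic = a%:E by [].
by rewrite lebesgue_measure_itv/= lte_fin a0 oppr0 adde0.
Qed.

(** Dominated convergence with dominating function C e^-|s|.  The theorem rests
on applying this to two families with the same limit law, so that the Gumbel
integral never has to be evaluated. *)
Lemma cvg_mean_sub (F : nat -> R -> R) (a : nat -> R) (C : R) : 0 <= C ->
  (forall n, 0 < a n) -> a n @[n --> \oo] --> +oo ->
  (forall n, mu.-integrable `]0, +oo[ (EFin \o (fun t => 1 - F n t))) ->
  (forall n t, 0 < t -> 0 <= F n t <= 1) ->
  (forall n s, 0 <= s -> 1 - F n (a n + s) <= C * expR (- s)) ->
  (forall n s, s < 0 -> 0 < a n + s -> F n (a n + s) <= C * expR s) ->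
  (forall s, F n (a n + s) @[n --> \oo] --> expR (- expR (- s))) ->
  (\int[mu]_(t in `]0, +oo[) (1 - F n t) - a n) @[n --> \oo] -->
    \int[mu]_s gumbel_excess s.
Proof.
move=> C0 a0 ay intF F01 Fr Fl Fcvg.
have inte n := (mean_sub_eq_integral_excess (a0 n) (intF n)).1.
under eq_fun do rewrite (mean_sub_eq_integral_excess (a0 _) (intF _)).2.
have me n : measurable_fun setT (EFin \o recentred_excess (F n) (a n)).
  exact: measurable_int (inte n).
pose g (s : R) := C * expR (- `|s|).
have intg : mu.-integrable setT (EFin \o g).
  exact: (integrableZl _ C integrable_expRN_norm).
have excess_le n s : `|recentred_excess (F n) (a n) s| <= g s.
  rewrite /recentred_excess /g; have [s0|s0] := leP 0 s.
    have as0 : 0 < a n + s by rewrite ltr_pwDl.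
    have /andP[_ F1] := F01 n _ as0.
    by rewrite as0 mul1r ger0_norm ?subr_ge0// ger0_norm// Fr.
  have [as0|as0] := ltP 0 (a n + s); last first.
    by rewrite mul0r subrr normr0 mulr_ge0 ?expR_ge0.
  have /andP[F0 _] := F01 n _ as0.
  by rewrite mul1r sub0r normrN ger0_norm// ltr0_norm// opprK Fl.
have excess_cvg (s : R) :
    recentred_excess (F n) (a n) s @[n --> \oo] --> gumbel_excess s.
  apply: cvgB; first exact: cvg_cst.
  rewrite -[X in _ --> X]mul1r; apply: cvgM => //.
  apply: cvg_near_cst; near=> n; suff -> : 0 < a n + s by [].
  rewrite -ltrBlDr; near: n; move/cvgryPgt : ay; exact.
have cvgE s : (EFin \o recentred_excess (F n) (a n)) s @[n --> \oo] -->
    (EFin \o gumbel_excess) s.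
  by apply: cvg_EFin; [exact: nearW|exact: excess_cvg].
have mG : measurable_fun setT (EFin \o gumbel_excess).
  by apply: emeasurable_fun_cvg me _ => s _; exact: cvgE.
have [||intG _ cvgI] := @dominated_convergence _ _ _ mu _ measurableT
    _ _ _ me mG _ intg _.
- by apply: aeW => s _; exact: cvgE.
- by apply: aeW => s n _; rewrite lee_fin; exact: excess_le.
apply: fine_cvg; rewrite /= fineK; last exact: integrable_fin_num.
exact: cvgI.
Unshelve. all: by end_near. Qed.
End recentred_means.

(** * Harmonic numbers as means of maxima of exponential variables *)

Section harmonic_numbers.
Context {R : realType}.
Notation mu := (@lebesgue_measure R).

Let m (t : R) := 1 - expR (- t).

Let m01 (t : R) : 0 < t -> 0 <= m t <= 1.
Proof.
move=> t0; rewrite /m subr_ge0 expR_le1 oppr_le0 (ltW t0)/=.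
by rewrite lerBlDr lerDl expR_ge0.
Qed.

Let is_derive_m (t : R) : is_derive t 1 m (expR (- t)).
Proof.
rewrite -[X in is_derive _ _ _ X]opprK -[X in is_derive _ _ _ X]sub0r.
exact: (@is_deriveB R R R (cst 1) _ t 1 0 _ (is_derive_cst _ _ _) (is_derive_expRN t)).
Qed.

Let continuous_m (t : R) : {for t, continuous m}.
Proof. exact: is_derive_continuous (is_derive_m t). Qed.

Let continuous_mX (k : nat) (t : R) : {for t, continuous (fun t => m t ^+ k)}.
Proof.
apply: (@continuous_comp _ _ _ m (fun y => y ^+ k)); first exact: continuous_m.
exact: exprn_continuous.
Qed.

Let integrable_expRN_mX (k : nat) :
  mu.-integrable `]0, +oo[ (EFin \o (fun t => m t ^+ k * expR (- t))).
Proof.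
apply: (@dominated_integrable_EFin _ _ _ (fun t => expR (- t))) => //.
- apply: continuous_ray_measurable => t _.
  by apply: cvgM; [exact: continuous_mX|exact: continuous_expRN].
- exact: integrable_expRN_ray.
- move=> t /=; rewrite in_itv/= andbT => /m01/andP[m0 m1].
  by rewrite ger0_norm ?mulr_ge0 ?exprn_ge0 ?expR_ge0// ler_piMl ?expR_ge0 ?exprn_ile1.
Qed.

Let Rintegral_expRN_mX (k : nat) :
  \int[mu]_(t in `]0, +oo[) (m t ^+ k * expR (- t)) = k.+1%:R^-1.
Proof.
pose G (t : R) := k.+1%:R^-1 * m t ^+ k.+1.
have dG (t : R) : is_derive t 1 G (m t ^+ k * expR (- t)).
  have -> : G = k.+1%:R^-1 *: (m ^+ k.+1) by rewrite exprfctE.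
  apply: (is_derive_eq (is_deriveZ k.+1%:R^-1 (is_deriveX k.+1 (is_derive_m t)))).
  by rewrite /GRing.scale/= -!mulrA mulKf.
have -> : k.+1%:R^-1 = k.+1%:R^-1 * 1 ^+ k.+1 - G 0 :> R.
  by rewrite /G /m oppr0 expR0 subrr !expr0n /= mulr0 subr0 expr1n mulr1.
apply: (@Rintegral_derive_ray _ _ G) => //.
- by move=> t _; apply: cvgM; [exact: continuous_mX|exact: continuous_expRN].
- by apply: cvg_at_right_filter; exact: is_derive_continuous (dG 0).
- apply: cvgM; first exact: cvg_cst.
  have m1 : m t @[t --> +oo] --> (1 : R).
    by rewrite -[X in _ --> X]subr0; apply: cvgB; [exact: cvg_cst|exact: cvgr_expR].
  exact: (cvg_comp m (fun y => y ^+ k.+1) m1 (@exprn_continuous _ _ _)).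
Qed.

(** With m = 1 - e^-t, the difference of 1 - m^(n+1) and 1 - m^n is
m^n e^-t, the derivative of m^(n+1) / (n+1). *)
Lemma integral_max_exponentials (n : nat) :
  mu.-integrable `]0, +oo[ (EFin \o (fun t => 1 - (1 - expR (- t)) ^+ n)) /\
  \int[mu]_(t in `]0, +oo[) (1 - (1 - expR (- t)) ^+ n) =
    \sum_(1 <= k < n.+1) (k%:R : R)^-1.
Proof.
elim: n => [|n [intn IH]].
  rewrite big_nil; split.
    apply: (eq_integrable _ (cst 0)) => //; last exact: integrable0.
    by move=> t _ /=; rewrite expr0 subrr.
  by under eq_Rintegral do rewrite expr0 subrr; rewrite Rintegral_cst// mul0r.
have E (t : R) : 1 - (1 - expR (- t)) ^+ n.+1 =
    (1 - (1 - expR (- t)) ^+ n) + m t ^+ n * expR (- t).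
  by rewrite /m exprS; ring.
split.
  have -> : EFin \o (fun t => 1 - (1 - expR (- t)) ^+ n.+1) = EFin \o
      (fun t => (1 - (1 - expR (- t)) ^+ n) + m t ^+ n * expR (- t)).
    by apply/funext => t /=; rewrite E.
  exact: (integrableD _ intn (integrable_expRN_mX n)).
under eq_Rintegral do rewrite E.
by rewrite RintegralD// IH Rintegral_expRN_mX [RHS]big_nat_recr//=.
Qed.

Lemma bernoulli_inequality (x : R) (n : nat) : 0 <= x <= 1 ->
  1 - (1 - x) ^+ n <= n%:R * x.
Proof.
case/andP=> x0 x1; elim: n => [|n IH]; first by rewrite expr0 subrr mul0r.
rewrite exprS -natr1.
have y0 : 0 <= 1 - x by rewrite subr_ge0.
have y1 : (1 - x) ^+ n <= 1 by rewrite exprn_ile1// lerBlDr lerDl.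
nra.
Qed.

Lemma one_minus_le_expRN (y : R) : 1 - y <= expR (- y).
Proof. exact: expR_ge1Dx. Qed.

(** For n > x, 1 - x/n lies between exp(-x / (n - x)) and exp(-x / n), both
bounds being instances of 1 + y <= e^y (the lower one after inversion, since
1 / (1 - x/n) = 1 + x / (n - x)). *)
Lemma cvg_one_minus_divn_exp (x : R) : 0 <= x ->
  (1 - x / n%:R) ^+ n @[n --> \oo] --> expR (- x).
Proof.
move=> x0.
have xn0 : x / n%:R @[n --> \oo] --> 0.
  rewrite -[X in _ --> X](mulr0 x); apply: cvgM; first exact: cvg_cst.
  apply/gtr0_cvgV0; last exact: cvgr_idn.
  by near=> n; rewrite ltr0n; near: n; exact: nbhs_infty_gt.
apply: (@squeeze_cvgr _ _ _ _ (fun n => expR (- (x / (1 - x / n%:R))))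
  (cst (expR (- x)))).
- near=> n.
  have n0 : 0 < n%:R :> R by rewrite ltr0n; near: n; exact: nbhs_infty_gt.
  have xn : x < n%:R by near: n; exact: nbhs_infty_gtr.
  have d0 : 0 < 1 - x / n%:R by rewrite subr_gt0 ltr_pdivrMr// mul1r.
  have nx0 : 0 < n%:R - x by rewrite subr_gt0.
  apply/andP; split.
    have -> : - (x / (1 - x / n%:R)) = n%:R * - (x / (n%:R - x)).
      by field; rewrite !gt_eqF.
    rewrite expRM_natl lerXn2r ?nnegrE ?expR_ge0 ?(ltW d0)//.
    rewrite expRN invf_ple ?posrE ?expR_gt0//.
    apply: le_trans (expR_ge1Dx _).
    rewrite le_eqVlt; apply/orP; left; apply/eqP.
    by field; rewrite !gt_eqF.
  have -> : - x = n%:R * - (x / n%:R) by field; rewrite gt_eqF.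
  by rewrite expRM_natl lerXn2r ?nnegrE ?expR_ge0 ?(ltW d0)// expR_ge1Dx.
- have cvgx : x / (1 - x / n%:R) @[n --> \oo] --> x.
    rewrite -[X in _ --> X]mulr1 -[X in _ * X]invr1; apply: cvgM; first exact: cvg_cst.
    apply: cvgV => //; rewrite -[X in _ --> X]subr0.
    by apply: cvgB => //; exact: cvg_cst.
  exact: (cvg_comp _ (fun y => expR (- y)) cvgx (@continuous_expRN _ _)).
- exact: cvg_cst.
Unshelve. all: by end_near. Qed.
End harmonic_numbers.

(** * Euler's constant as the mean of the Gumbel law *)

Section euler_constant.
Context {R : realType}.
Notation mu := (@lebesgue_measure R).

Lemma expRN_le_inv (x : R) : 0 < x -> expR (- x) <= x^-1.
Proof.
move=> x0; rewrite expRN lef_pV2 ?posrE ?expR_gt0//.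
by apply: le_trans (expR_ge1Dx _); rewrite lerDr.
Qed.

Lemma cvg_lny : ln x @[x --> +oo] --> (+oo : set_system R).
Proof.
apply/cvgryPge => A; near=> x.
have x0 : 0 < x by near: x; exact: (nbhs_pinfty_gt (num_real _)).
rewrite -ler_expR lnK ?posrE//; near: x; exact: (nbhs_pinfty_ge (num_real _)).
Unshelve. all: by end_near. Qed.

Lemma cvg_lnn : ln (n%:R : R) @[n --> \oo] --> +oo.
Proof. exact: (cvg_comp (fun n => n%:R) (@ln R) cvgr_idn cvg_lny). Qed.

(** The recentred laws are (1 - e^-s / n)^n.  Bernoulli's inequality bounds
their right tails by e^-s; on the left they are at most
exp(-e^-s) <= 1 / e^-s = e^s. *)
Lemma cvg_harmonic_sub_ln :
  (\sum_(1 <= k < n.+1) (k%:R : R)^-1 - ln n%:R) @[n --> \oo] -->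
    \int[mu]_s gumbel_excess s.
Proof.
(* The recentring point ln n has to be positive, so n starts at 2. *)
rewrite -(cvg_shiftn 2)/=.
under eq_fun do rewrite -(integral_max_exponentials _).2.
pose N (n : nat) : R := (n + 2)%:R.
have N0 n : 0 < N n by rewrite /N ltr0n addn2.
have shiftE n s : expR (- (ln (N n) + s)) = expR (- s) / N n.
  by rewrite opprD expRD (expRN (ln _)) lnK ?posrE// mulrC.
have base01 (t : R) : 0 < t -> 0 <= 1 - expR (- t) <= 1.
  move=> t0; rewrite subr_ge0 expR_le1 oppr_le0 (ltW t0)/=.
  by rewrite lerBlDr lerDl expR_ge0.
apply: (@cvg_mean_sub R (fun n t => (1 - expR (- t)) ^+ (n + 2))
  (fun n => ln (N n)) 1) => //.
- by move=> n; rewrite ln_gt0// /N addn2 ltr1n.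
- by have := cvg_lnn; rewrite -(cvg_shiftn 2).
- by move=> n; exact: (integral_max_exponentials _).1.
- move=> n t /(base01)/andP[b0 b1]; by rewrite exprn_ge0//= exprn_ile1.
- move=> n s s0; rewrite shiftE mul1r.
  have N1 : 1 <= N n by rewrite /N addn2 ler1n.
  apply: (@le_trans _ _ (N n * (expR (- s) / N n))); last first.
    by rewrite mulrC divfK// gt_eqF.
  apply: bernoulli_inequality.
  rewrite divr_ge0 ?expR_ge0 ?(ltW (N0 n))//= ler_pdivrMr// mul1r.
  by apply: le_trans N1; rewrite expR_le1 oppr_le0.
- move=> n s s0 as0; rewrite mul1r shiftE.
  have b0 : 0 <= 1 - expR (- s) / N n.
    by rewrite -shiftE; have /andP[] := base01 _ as0.
  apply: (@le_trans _ _ (expR (- expR (- s)))); last first.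
    by apply: (le_trans (expRN_le_inv (expR_gt0 _))); rewrite expRN invrK.
  have -> : - expR (- s) = (n + 2)%:R * - (expR (- s) / N n).
    by rewrite -/(N n) mulrN mulrC divfK// gt_eqF.
  by rewrite expRM_natl lerXn2r ?nnegrE ?expR_ge0// one_minus_le_expRN.
- move=> s; under eq_fun do rewrite shiftE.
  have := @cvg_one_minus_divn_exp R (expR (- s)) (expR_ge0 _).
  by rewrite -(cvg_shiftn 2).
Qed.

Lemma euler_gamma_gumbel : euler_gamma R = \int[mu]_s gumbel_excess s.
Proof. by apply: cvg_lim => //; exact: cvg_harmonic_sub_ln. Qed.
End euler_constant.

(** * The limit for large theta *)

Section large_theta.
Context {R : realType}.
Notation mu := (@lebesgue_measure R).

(** With y = ln x, the inequality 1 + y^2 / 2 <= e^y gives ln x / x <= 2 / ln x. *)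
Lemma cvg_ln_divy : ln x / x @[x --> +oo] --> (0 : R).
Proof.
apply: (@squeeze_cvgr _ _ _ _ (cst 0) (fun x => 2 / ln x)).
- near=> x.
  have x1 : 1 < x by near: x; exact: (nbhs_pinfty_gt (num_real _)).
  have x0 : 0 < x by exact: lt_trans x1.
  have l0 : 0 < ln x by exact: ln_gt0.
  rewrite divr_ge0 ?(ltW l0) ?(ltW x0)//= ler_pdivrMr// mulrAC ler_pdivlMr//.
  have := @expR_ge1Dxn _ (ln x) 1 (ltW l0); rewrite lnK ?posrE//.
  rewrite (_ : 2`! = 2%N)// expr2; set y := ln x * ln x; lra.
- exact: cvg_cst.
- rewrite -[X in _ --> X](mulr0 2); apply: cvgM; first exact: cvg_cst.
  apply/gtr0_cvgV0; last exact: cvg_lny.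
  by near=> x; rewrite ln_gt0//; near: x; exact: (nbhs_pinfty_gt (num_real _)).
Unshelve. all: by end_near. Qed.

(** L <= (1 + L/4)^2 <= (e^(L/4))^2, the first step being
(1 - L/4)^2 >= 0.  This makes ln theta - ln ln theta at least half of
ln theta, which is what keeps the dominating constants uniform. *)
Lemma ln_le_half (L : R) : 0 < L -> ln L <= L / 2.
Proof.
move=> L0; rewrite -ler_expR lnK ?posrE//.
rewrite (_ : L / 2 = 2%:R * (L / 4)); last by field.
rewrite expRM_natl.
have L4 : 0 <= 1 + L / 4 by rewrite addr_ge0// divr_ge0// ltW.
apply: (@le_trans _ _ ((1 + L / 4) ^+ 2)).
  by rewrite -subr_ge0 (_ : _ - L = (1 - L / 4) ^+ 2) ?sqr_ge0//; field.
by rewrite lerXn2r ?nnegrE ?expR_ge0// expR_ge1Dx.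
Qed.

Lemma cvg_div_sub_ln (c : R) : L / (L - ln L + c) @[L --> +oo] --> (1 : R).
Proof.
have h : (1 - ln L / L + c / L)^-1 @[L --> +oo] --> (1 : R).
  rewrite -[X in _ --> X]invr1; apply: cvgV => //.
  rewrite -[X in _ --> X]addr0; apply: cvgD.
    rewrite -[X in _ --> X]subr0; apply: cvgB; first exact: cvg_cst.
    exact: cvg_ln_divy.
  rewrite -[X in _ --> X](mulr0 c); apply: cvgM; first exact: cvg_cst.
  exact: ((@gtr0_cvgV0 R R (pinfty_nbhs R) _ id (nbhs_pinfty_gt _)).2 cvg_id).
apply: cvg_trans h; apply: near_eq_cvg; near=> L.
have L0 : 0 < L by near: L; exact: (nbhs_pinfty_gt (num_real _)).
have Lc : 0 < L - ln L + c.
  have := ln_le_half L0; suff : - c < L / 2 by lra.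
  by rewrite ltr_pdivlMr//; near: L; exact: (nbhs_pinfty_gt (num_real _)).
field; rewrite !gt_eqF//; lra.
Unshelve. all: by end_near. Qed.

Lemma scaled_expRN_recentred (theta s : R) : 0 < theta -> 1 <= ln theta ->
  theta * expR (- (ln theta - ln (ln theta) + s)) = ln theta * expR (- s).
Proof.
move=> th0 L1; have L0 : 0 < ln theta by exact: lt_le_trans L1.
rewrite opprD expRD mulrA opprB expRB; congr (_ * _).
by rewrite !lnK ?posrE// mulrC divfK ?gt_eqF.
Qed.

Lemma scaled_expint1_le (theta s : R) : 0 < theta -> 1 <= ln theta ->
  let a := ln theta - ln (ln theta) in 0 < a + s ->
  theta * expint1 (a + s) <= ln theta / (a + s) * expR (- s).
Proof.
move=> th0 L1 a as0.
rewrite mulrAC -scaled_expRN_recentred// -mulrA ler_wpM2l ?(ltW th0)//.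
exact: expint1_le.
Qed.

Lemma scaled_expint1_ge (theta s : R) : 0 < theta -> 1 <= ln theta ->
  let a := ln theta - ln (ln theta) in 0 < a + s ->
  ln theta / (a + s + 1) * expR (- s) <= theta * expint1 (a + s).
Proof.
move=> th0 L1 a as0.
rewrite mulrAC -scaled_expRN_recentred// -mulrA ler_wpM2l ?(ltW th0)//.
exact: expint1_ge.
Qed.

(** The recentred laws exp(-theta E1(a + s)) satisfy the domination with C = 2:
on the right 1 - F <= theta E1 and ln theta / (a + s) <= 2, on the left
ln theta / (a + s + 1) >= 1/2 and exp(-e^-s / 2) <= 2 e^s. *)
Lemma cvg_golomb_dickman_recentred :
  (theta * golomb_dickman theta - (ln theta - ln (ln theta))) @[theta --> +oo]
    --> euler_gamma R.
Proof.
apply/cvg_pinftyP => v vy.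
(* Drop the first terms of the sequence to have ln theta >= 1 throughout. *)
have [N _ vN] : \forall n \near \oo, expR 1 <= v n by move/cvgryPge : vy; exact.
rewrite -(cvg_shiftn N)/=; pose u n := v (n + N)%N.
have uy : u n @[n --> \oo] --> +oo by rewrite /u cvg_shiftn.
have u_ge n : expR 1 <= u n by apply: vN; rewrite /= leq_addl.
have u0 n : 0 < u n by exact: lt_le_trans (expR_gt0 _) (u_ge n).
have L1 n : 1 <= ln (u n) by rewrite -ler_expR lnK ?posrE.
have L0 n : 0 < ln (u n) by exact: lt_le_trans (L1 n).
have lnL0 n : 0 <= ln (ln (u n)) by exact: ln_ge0.
have lnL n := ln_le_half (L0 n).
have Ly : ln (u n) @[n --> \oo] --> +oo.
  exact: (cvg_comp u (@ln R) uy cvg_lny).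
pose a n := ln (u n) - ln (ln (u n)).
have a0 n : 0 < a n by have := L0 n; have := lnL n; rewrite /a; lra.
rewrite euler_gamma_gumbel.
under eq_fun do rewrite golomb_dickman_mean ?(ltW (u0 _))//.
apply: (@cvg_mean_sub R (fun n => gd_cdf (u n)) a 2) => //.
- apply/cvgryPge => A; near=> n.
  have : 2 * A <= ln (u n) by near: n; move/cvgryPge : Ly; exact.
  by have := lnL n; rewrite /a; lra.
- by move=> n; apply: integrable_gd_tail; exact: ltW.
- by move=> n t t0; rewrite gd_cdf_ge0 gd_cdf_le1// ltW.
- move=> n s s0; have as0 : 0 < a n + s by rewrite ltr_pwDl.
  have tail : 1 - gd_cdf (u n) (a n + s) <= u n * expint1 (a n + s).
    by rewrite lerBlDl -lerBlDr expR_ge1Dx.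
  apply: (le_trans tail); apply: (le_trans (scaled_expint1_le (u0 n) (L1 n) as0)).
  rewrite ler_wpM2r ?expR_ge0// ler_pdivrMr//.
  by have := lnL n; rewrite /a; lra.
- move=> n s s0 as0.
  have key : 2^-1 * expR (- s) <= u n * expint1 (a n + s).
    apply: le_trans (scaled_expint1_ge (u0 n) (L1 n) as0).
    rewrite ler_wpM2r ?expR_ge0// ler_pdivlMr; last by rewrite ltr_wpDr.
    by have := L1 n; have := lnL0 n; rewrite /a; lra.
  rewrite /gd_cdf; apply: (@le_trans _ _ (expR (- (2^-1 * expR (- s))))).
    by rewrite ler_expR lerN2.
  apply: (le_trans (expRN_le_inv _)); first by rewrite mulr_gt0 ?expR_gt0.
  by rewrite invfM invrK expRN invrK.
- move=> s.
  have cvgL c : (ln (u n) / (a n + c)) * expR (- s) @[n --> \oo] --> expR (- s).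
    rewrite -[X in _ --> X]mul1r; apply: cvgM; last exact: cvg_cst.
    have := cvg_comp _ (fun L => L / (L - ln L + c)) Ly (@cvg_div_sub_ln c).
    exact.
  have as0 : \forall n \near \oo, 0 < a n + s.
    near=> n.
    have : - 2 * s + 1 <= ln (u n) by near: n; move/cvgryPge : Ly; exact.
    by have := lnL n; rewrite /a; lra.
  have E : u n * expint1 (a n + s) @[n --> \oo] --> expR (- s).
    apply: squeeze_cvgr (cvgL (s + 1)) (cvgL s); near=> n.
    have asn : 0 < a n + s by near: n.
    rewrite addrA scaled_expint1_ge// scaled_expint1_le//.
  exact: (cvg_comp _ (fun y => expR (- y)) E (@continuous_expRN _ _)).
Unshelve. all: by end_near. Qed.
End large_theta.

Theorem proposition4p5 (R : realType) :
  (fun theta : R => golomb_dickman theta) =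
  (fun theta : R =>
     ln theta / theta - (ln (ln theta) - euler_gamma R) / theta)
  +o_ (pinfty_nbhs R) (fun theta : R => theta^-1).
Proof.
apply/eqaddoP => e e0; near=> theta.
have th0 : 0 < theta by near: theta; exact: (nbhs_pinfty_gt (num_real _)).
rewrite !fctE.
have -> : golomb_dickman theta -
    (ln theta / theta - (ln (ln theta) - euler_gamma R) / theta) =
    (theta * golomb_dickman theta - (ln theta - ln (ln theta)) - euler_gamma R)
    * theta^-1.
  by field; rewrite gt_eqF.
rewrite normrM ler_wpM2r// distrC ltW//; near: theta.
exact: (cvgr_dist_lt _ _ cvg_golomb_dickman_recentred _ e0).
Unshelve. all: by end_near. Qed.
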